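(* Let $B$ be a finite ring with $2\in B^\times$, having an involution $*$ and a primitive group homomorphism $\beta:B^+\to\mathbb{C}^\times$ such that $\beta(b+b^* )=1$ for all $b\in B$. Let $m=2n\ge 2$ be even and $A=M(m,B)$. The Weil representation $W:\mathrm{SL}^{+}_*(2,A)\to\mathrm{GL}(X)$ of type $\beta$ is given as follows on the Bruhat elements: $$W(h_T)e_a=\mu(T)e_{(T^* )^{-1}a},\quad a\in B^m,\ T\in A^\times,$$ $$W(u_S)e_a=\beta(-a^*Sa)e_a,\quad a\in B^m,\ S\in A,\ S^*=-S,$$ $$W(\omega)e_a=\frac{1}{|B|^n}\sum_{b\in B^m}\beta(2a^*b)e_b,\quad a\in B^m.$$
   Context: Rings have identity $1\ne0$; an involution is an antiautomorphism of order 1 or 2, extended to $A=M(m,B)$ by $(x^* )_{ij}=(x_{ji})^*$. $\beta$ is primitive if its kernel contains no right ideal of $B$ other than $(0)$. $B^m$ is the space of column vectors, and $a^*$ denotes the row vector $(a_1^*,\dots,a_m^* )$. $\mathrm{SL}^{+}_*(2,A)$ is the group of all $g\in\mathrm{GL}(2m,B)$ with $g^*Jg=J$, $J=\begin{pmatrix}0&1_m\\ 1_m&0\end{pmatrix}$. Bruhat elements: $\omega=\begin{pmatrix}0&1_m\\1_m&0\end{pmatrix}$, $h_T=\begin{pmatrix}T&0\\0&(T^* )^{-1}\end{pmatrix}$, $u_S=\begin{pmatrix}1_m&S\\0&1_m\end{pmatrix}$ with $T\in A^\times$, $S^*=-S$. Let $I\subset B^m\setminus\{0\}$ contain exactly one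 element of each set $\{v,-v\}$, $0\neq v\in B^m$. For $Y\in\mathrm{GL}(m,B)$ put $I_Y=\{v\in I:Yv\in-I\}$ and $\mu(Y)=(-1)^{|I_Y|}$; $\mu$ is a group homomorphism $\mathrm{GL}(m,B)\to\{1,-1\}$ independent of $I$. Weil representation: Let $V$ be a free right $B$-module with basis $u_1,\dots,u_m,v_1,\dots,v_m$ and $h:V\times V\to B$ the hermitian form ($B$-linear in the second variable, $h(u,v)^*=h(v,u)$) with Gram matrix $J$ in this basis; $\mathrm{SL}^{+}_*(2,A)$ is identified with the unitary group of $h$ via matrices in this basis. Let $M$, $N$ be the spans of the $u_i$ and the $v_i$, and identify $N$ with $B^m$ via $\sum v_ia_i\leftrightarrow a$. Let $X$ be a complex vector space with basis $(e_a)_{a\in B^m}$. The Heisenberg group $H$ is the set $B\times V$ with $(b,u)(c,v)=(b+c+h(u,v),u+v)$; $g$ acts on it by ${}^g(b,u)=(b,gu)$. The Schrödinger representation $S:H\to\mathrm{GL}(X)$ of type $\beta$ is determined by $S(b,0)e_v=\beta(b)e_v$, $S(0,w)e_v=e_{v+w}$, $S(0,u)e_v=\beta(2h(u,v))e_v$ for $b\in B$, $v,w\in N$, $u\in M$. For each $g$ there is $P(g)\in\mathrm{GL}(X)$, unique up to scaling, with $P(g)S(k)P(g)^{-1}=S({}^gk)$ for all $k\in H$. Let $X_\pm$ be the $\pm1$-eigenspaces of the operator $e_v\mapsto e_{-v}$; they are preserved by all $P(g)$. Put $c(g)=(\det P(g)|_{X_+})^{-1}\det P(g)|_{X_-}$.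 Then $W(g)=c(g)P(g)$ is independent of the scaling of $P(g)$ and is a representation, called the Weil representation of type $\beta$. *)

(* Defs.v *)
From HB Require Import structures.
From mathcomp Require Import all_boot all_order all_algebra.
From mathcomp Require Import classical_sets reals.
From mathcomp.real_closed Require Import complex.

Set Implicit Arguments.
Unset Strict Implicit.
Unset Printing Implicit Defensive.

Import Order.TTheory GRing.Theory Num.Theory.
Local Open Scope ring_scope.

Record involution (B : nzRingType) := Involution {
  inv_fun :> B -> B;
  inv_add : {morph inv_fun : x y / x + y};
  inv_mul : forall x y, inv_fun (x * y) = inv_fun y * inv_fun x;
  inv_invol : involutive inv_fun
}.

Section Matrices.
Variables (B : finNzRingType) (star : involution B).

(* Conjugate transpose. For a column [a] it is the row of the [a_i^*]. *)
Definition star_mx p q (A : 'M[B]_(p, q)) : 'M[B]_(q, p) := (map_mx star A)^T.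

(* [B] need not be commutative, so the library's [unitmx] and [invmx] do not
   apply; as there, the inverse of a non-invertible matrix is itself. *)
Definition is_inverse k (T T' : 'M[B]_k) : bool :=
  (T *m T' == 1%:M) && (T' *m T == 1%:M).

Definition GL_mx k (T : 'M[B]_k) : bool := [exists T', is_inverse T T'].

Definition inv_mx k (T : 'M[B]_k) : 'M[B]_k :=
  odflt T [pick T' | is_inverse T T'].

Definition J_mx m : 'M[B]_(m + m) := block_mx 0 1%:M 1%:M 0.

Definition in_SLplus m (g : 'M[B]_(m + m)) : bool :=
  GL_mx g && (star_mx g *m J_mx m *m g == J_mx m).

Definition SLplus m := {g : 'M[B]_(m + m) | in_SLplus g}.

Definition omega_mx m : 'M[B]_(m + m) := block_mx 0 1%:M 1%:M 0.

Definition h_mx m (T : 'M[B]_m) : 'M[B]_(m + m) :=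
  block_mx T 0 0 (inv_mx (star_mx T)).

Definition u_mx m (S : 'M[B]_m) : 'M[B]_(m + m) := block_mx 1%:M S 0 1%:M.

Lemma inv0 : star 0 = 0.
Proof. by apply: (addrI (star 0)); rewrite -inv_add !addr0. Qed.

Lemma inv1 : star 1 = 1.
Proof.
by rewrite -[RHS](inv_invol star) -[star 1 in RHS]mul1r inv_mul inv_invol mul1r.
Qed.

Lemma inv_sum I (r : seq I) (P : pred I) (F : I -> B) :
  star (\sum_(i <- r | P i) F i) = \sum_(i <- r | P i) star (F i).
Proof. exact: (big_morph _ (inv_add star) inv0). Qed.

Lemma star_mxK p q (A : 'M[B]_(p, q)) : star_mx (star_mx A) = A.
Proof. by apply/matrixP=> i j; rewrite !mxE inv_invol. Qed.

Lemma star_mxM p q r (A : 'M[B]_(p, q)) (C : 'M[B]_(q, r)) :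
  star_mx (A *m C) = star_mx C *m star_mx A.
Proof.
apply/matrixP=> i j; rewrite !mxE inv_sum; apply: eq_bigr => k _.
by rewrite !mxE inv_mul.
Qed.

Lemma star_mx0 p q : star_mx (0 : 'M[B]_(p, q)) = 0.
Proof. by apply/matrixP=> i j; rewrite !mxE inv0. Qed.

Lemma star_mx1 k : star_mx (1%:M : 'M[B]_k) = 1%:M.
Proof.
by apply/matrixP=> i j; rewrite !mxE eq_sym; case: eqP; rewrite /= ?inv1 ?inv0.
Qed.

Lemma star_block p1 p2 q1 q2 (X : 'M[B]_(p1, q1)) (Y : 'M_(p1, q2))
    (Z : 'M_(p2, q1)) (T : 'M_(p2, q2)) :
  star_mx (block_mx X Y Z T)
  = block_mx (star_mx X) (star_mx Z) (star_mx Y) (star_mx T).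
Proof. by rewrite /star_mx map_block_mx tr_block_mx. Qed.

Lemma inv_mxP k (T : 'M[B]_k) : GL_mx T -> is_inverse T (inv_mx T).
Proof.
move=> /existsP[T' hT']; rewrite /inv_mx; case: pickP => //= /(_ T').
by rewrite hT'.
Qed.

Lemma star_GL_mx k (T : 'M[B]_k) : GL_mx T -> GL_mx (star_mx T).
Proof.
move=> /existsP[T' /andP[/eqP h1 /eqP h2]]; apply/existsP; exists (star_mx T').
by rewrite /is_inverse -!star_mxM h1 h2 star_mx1 eqxx.
Qed.

Lemma omega_mx_SLplus m : in_SLplus (omega_mx m).
Proof.
have ww : omega_mx m *m omega_mx m = 1%:M.
  by rewrite mulmx_block !mul0mx !mulmx0 !mulmx1 !addr0 !add0r -scalar_mx_block.
rewrite /in_SLplus; apply/andP; split.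
  by apply/existsP; exists (omega_mx m); rewrite /is_inverse ww eqxx.
by rewrite -mulmxA ww mulmx1 star_block !star_mx0 !star_mx1.
Qed.

Lemma h_mx_SLplus m (T : 'M[B]_m) : GL_mx T -> in_SLplus (h_mx T).
Proof.
move=> hT.
have /andP[/eqP a1 /eqP a2] := inv_mxP hT.
have /andP[/eqP b1 /eqP b2] := inv_mxP (star_GL_mx hT).
rewrite /in_SLplus; apply/andP; split.
  apply/existsP; exists (block_mx (inv_mx T) 0 0 (star_mx T)).
  rewrite /is_inverse !mulmx_block !mul0mx !mulmx0 !addr0 !add0r a1 a2 b1 b2.
  by rewrite -scalar_mx_block eqxx.
rewrite star_block !mulmx_block !star_mx0 !mul0mx !mulmx0 !mulmx1 !addr0 !add0r.
rewrite !mul0mx b1.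
suff -> : star_mx (inv_mx (star_mx T)) *m T = 1%:M by [].
by rewrite -[X in _ *m X]star_mxK -star_mxM b1 star_mx1.
Qed.

Lemma u_mx_SLplus m (S : 'M[B]_m) : star_mx S = - S -> in_SLplus (u_mx S).
Proof.
move=> hS; rewrite /in_SLplus; apply/andP; split.
  apply/existsP; exists (u_mx (- S)).
  rewrite /is_inverse !mulmx_block !mul0mx !mulmx0 !mul1mx !mulmx1 !addr0 !add0r.
  by rewrite subrr addNr -scalar_mx_block eqxx.
rewrite star_block !mulmx_block !star_mx0 !star_mx1 hS.
by rewrite !mul0mx !mulmx0 !mulmx1 !addr0 !add0r mul0mx mul1mx add0r addrN.
Qed.

Definition omega m : SLplus m := exist (@in_SLplus m) _ (omega_mx_SLplus m).

Definition bruhat_h m (T : 'M[B]_m) (hT : GL_mx T) : SLplus m :=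
  exist (@in_SLplus m) _ (h_mx_SLplus hT).

Definition bruhat_u m (S : 'M[B]_m) (hS : star_mx S = - S) : SLplus m :=
  exist (@in_SLplus m) _ (u_mx_SLplus hS).

(* A set containing exactly one element of each [{v, -v}] with [v != 0]. *)
Definition half_system m (I : {set 'cV[B]_m}) : Prop :=
  0 \notin I /\ forall v : 'cV[B]_m, v != 0 -> #|I :&: [set v; - v]| = 1%N.

Definition mu (C : fieldType) m (I : {set 'cV[B]_m}) (Y : 'M[B]_m) : C :=
  (-1) ^+ #|[set v in I | Y *m v \in [set - w | w in I]]|.

End Matrices.

Section Characters.
Variables (B : finNzRingType) (C : fieldType).

Definition add_char (beta : B -> C) : Prop :=
  (forall x, beta x != 0) /\ {morph beta : x y / x + y >-> x * y}.

Definition right_ideal (K : {set B}) : Prop :=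
  [/\ 0 \in K,
      forall x y, x \in K -> y \in K -> x - y \in K
    & forall x b, x \in K -> x * b \in K].

Definition primitive (beta : B -> C) : Prop :=
  forall K : {set B}, right_ideal K ->
    (forall x, x \in K -> beta x = 1) -> K = [set 0].

End Characters.

Section Weil.
Variables (B : finNzRingType) (star : involution B) (C : fieldType).
Variables (beta : B -> C) (m : nat).

(* [V] in coordinates: the first [m] are those on the [u_i] (spanning [M]),
   the last [m] those on the [v_i] (spanning [N]). *)
Local Notation V := 'cV[B]_(m + m).

Definition in_M (u : 'cV[B]_m) : V := col_mx u 0.
Definition in_N (v : 'cV[B]_m) : V := col_mx 0 v.

Definition herm (x y : V) : B := (star_mx star x *m J_mx B m *m y) 0 0.

Definition heis : Type := B * V.

Definition heis_mul (k l : heis) : heis :=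
  (k.1 + l.1 + herm k.2 l.2, k.2 + l.2).

Definition heis_act (g : SLplus star m) (k : heis) : heis :=
  (k.1, val g *m k.2).

(* The space [X] with basis [e_a]. The field is written [C^o] so that it is
   taken as a vector space over itself (complex numbers over a real closed
   field [R] are also a vector space over [R]). *)
Definition wspace : vectType C := {ffun 'cV[B]_m -> C^o}.

Definition e (a : 'cV[B]_m) : wspace := [ffun x => (x == a)%:R].

Definition on_basis_fun (f : 'cV[B]_m -> wspace) (x : wspace) : wspace :=
  \sum_(a : 'cV[B]_m) (x : {ffun 'cV[B]_m -> C^o}) a *: f a.

Lemma on_basis_is_linear f : linear (on_basis_fun f).
Proof.
move=> c x y; rewrite /on_basis_fun scaler_sumr -big_split /=.
by apply: eq_bigr => a _; rewrite !ffunE scalerDl scalerA.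
Qed.

HB.instance Definition _ f :=
  GRing.isLinear.Build C wspace wspace _ (on_basis_fun f)
    (on_basis_is_linear f).

(* The operator e_a |-> f a. *)
Definition on_basis (f : 'cV[B]_m -> wspace) : 'End(wspace) :=
  linfun (on_basis_fun f).

Lemma on_basisE f v : on_basis f (e v) = f v.
Proof.
rewrite lfunE /= /on_basis_fun (bigD1 v) //= big1 => [|a /negbTE av].
  by rewrite ffunE eqxx scale1r addr0.
by rewrite ffunE av scale0r.
Qed.

Definition schrodinger (S : heis -> 'End(wspace)) : Prop :=
  [/\ S (0, 0) = \1%VF,
      forall k l, S (heis_mul k l) = (S k \o S l)%VF,
      forall b v, S (b, 0) (e v) = beta b *: e v,
      forall w v, S (0, in_N w) (e v) = e (v + w)
    & forall u v,
        S (0, in_M u) (e v) = beta (2%:R * herm (in_M u) (in_N v)) *: e v].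

(* [P] satisfies the defining property of [P(g)]. *)
Definition intertwiner (S : heis -> 'End(wspace)) (g : SLplus star m)
    (P : 'End(wspace)) : Prop :=
  lker P == 0%VS /\
  forall k, (P \o S k \o P^-1)%VF = S (heis_act g k).

(* The operator e_v |-> e_{-v}. *)
Definition reflection : 'End(wspace) := on_basis (fun v => e (- v)).

Definition X_plus : {vspace wspace} := lker (reflection - \1%VF).
Definition X_minus : {vspace wspace} := lker (reflection + \1%VF).

(* Determinant of the restriction of [f] to a stable subspace [U]. *)
Definition det_on (U : {vspace wspace}) (f : 'End(wspace)) : C :=
  \det (\matrix_(i < \dim U, j < \dim U)
          coord (vbasis U) j (f (vbasis U)`_i)).

Definition c_factor (P : 'End(wspace)) : C :=
  (det_on X_plus P)^-1 * det_on X_minus P.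

(* [c_factor P *: P] does not depend on the scaling of [P]; an intertwiner
   [P(g)] is picked by choice. *)
Definition weil (S : heis -> 'End(wspace)) (g : SLplus star m) :
    'End(wspace) :=
  let P := xget 0 (intertwiner S g) in c_factor P *: P.

End Weil.

(* Main.v *)
From HB Require Import structures.
Require Import Defs.
From mathcomp Require Import all_boot all_order all_algebra ring zify.
From mathcomp Require Import reals.
From mathcomp Require classical_sets.
From mathcomp.real_closed Require Import complex.
Import GRing.Theory Num.Theory.
Local Open Scope ring_scope.
Set Implicit Arguments.
Unset Strict Implicit.
Unset Printing Implicit Defensive.

(** Each Bruhat element has a visible intertwiner: a permutation operator for
[h_T], a multiplication operator for [u_S], the Fourier operator
[F e_a = \sum_b beta (2 a^* b) e_b] for [omega]. Intertwiners of a given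
element differ by scalars (Schur's lemma, [intertwiner_uniq]), and
[dim X_+ = dim X_- + 1] makes [c_factor P *: P] insensitive to the scalar
([c_factorZ]); so the arbitrary choice made in [weil] does not matter, and
[W g] is read off any intertwiner whose [c_factor] is known ([weilE]). What
remains is three quotients of determinants.

Let [I] be a half system. The vectors [e_0], [e_v + e_{-v}] for [v] in [I]
form a basis of [X_+], the vectors [e_v - e_{-v}] one of [X_-], and in both the
coordinates of a function are its values at [0] and at the points of [I].

- For a permutation or a multiplication operator, the matrix on [X_-] is a
  diagonal sign matrix times the matrix on [X_+] with [e_0] removed, so the
  quotient is the product of the signs ([c_factor_signs]). It is [1] for
  [u_S], and [mu T] for the operator [e_a |-> e_{Ta}]. The operator wanted for
  [h_T] uses the inverse of [T^*] instead of [T]; Fourier conjugates one into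
  the other ([fourier_mx_op]), and [c_factor] is a conjugation invariant.

- For Fourier, [beta (2 a^* b)] is skew in [a, b] because
  [beta (x + star x) = 1]. Hence [F^2 = |B|^m] and [F] is diagonalizable with
  eigenvalues [+-|B|^n], so its determinants on [X_+] and [X_-] are governed
  by the multiplicities of [-|B|^n], and these by traces. Since
  [beta (2 a^* a) = 1], the trace is [|B|^m] on [X_+] and [0] on [X_-]. The
  quotient is [|B|^{-n}] up to the sign [(-1)^k], with
  [k = |B|^n (|B|^n - 1) / 2] the total multiplicity. This sign is [1] as
  soon as [|B|^n = 1] modulo [4], which holds because [|B|] is an odd square:
  in dimension one, the trace [|B|] of [F] is an integer multiple of its
  eigenvalue [sqrt |B|] ([card_square]). *)

(** * Involutive matrices *)

(** Sylvester's identity, from the two block factorizations of the matrix with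
blocks [1, A, B, 1]. *)
Lemma det_1subM (C : comPzRingType) p q (A : 'M[C]_(p, q)) (B : 'M[C]_(q, p)) :
  \det (1%:M - A *m B) = \det (1%:M - B *m A).
Proof.
have e1 : block_mx 1%:M A B 1%:M
        = block_mx 1%:M 0 B 1%:M *m block_mx 1%:M A 0 (1%:M - B *m A).
  by rewrite mulmx_block !mul1mx !mulmx1 !mul0mx !addr0 addrC subrK.
have e2 : block_mx 1%:M A B 1%:M
        = block_mx 1%:M A 0 1%:M *m block_mx (1%:M - A *m B) 0 B 1%:M.
  by rewrite mulmx_block !mul1mx !mulmx1 !mul0mx !add0r subrK.
have := congr1 determinant e2; rewrite {1}e1 !det_mulmx.
by rewrite !det_ublock !det_lblock !det1 !mul1r mulr1.
Qed.

(** A rank factorization [E = L *m K] of an idempotent satisfies [K *m L = 1];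
trace and determinant are then computed on the small side. *)
Lemma idempotent_trace_det (C : fieldType) p (E : 'M[C]_p) :
  E *m E = E ->
  \tr E = (\rank E)%:R /\ \det (1%:M - 2%:R *: E) = (-1) ^+ \rank E.
Proof.
move=> EE; set L := col_base E; set K := row_base E.
have LK : L *m K = E := mulmx_base E.
have KL : K *m L = 1%:M.
  apply: (row_free_inj (row_base_free E)).
  apply: (row_full_inj (col_base_full E)).
  by rewrite -/L -/K mul1mx -mulmxA !LK mulmxA LK EE.
split; first by rewrite -[in LHS]LK mxtrace_mulC KL mxtrace1.
rewrite -[in LHS]LK scalemxAl det_1subM -scalemxAr KL.
have -> : 1%:M - 2%:R *: 1%:M = (-1)%:M :> 'M[C]_(\rank E).
  rewrite scaler_nat mulr2n opprD addrA subrr add0r.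
  by rewrite raddfN.
by rewrite det_scalar.
Qed.

(** [k] is the multiplicity of the eigenvalue [-1], that is the rank of the
projector [(1 - M) / 2]. It links the trace to the determinant, which is how
every sign of a Fourier determinant is found below. *)
Lemma involutive_mx_trace_det (C : fieldType) p (M : 'M[C]_p) :
  2%:R != 0 :> C -> M *m M = 1%:M ->
  exists k : nat, \tr M = p%:R - (2 * k)%:R /\ \det M = (-1) ^+ k.
Proof.
move=> n2 MM; pose E := 2%:R^-1 *: (1%:M - M).
have E2 : 2%:R *: E = 1%:M - M by rewrite scalerA divff ?scale1r.
have EE : E *m E = E.
  rewrite -scalemxAl -scalemxAr mulmxBl !mulmxBr MM !mul1mx mulmx1.
  rewrite opprB addrACA -opprD -mulr2n -[M + M]mulr2n -mulrnBl -scaler_nat.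
  by rewrite (scalerA 2%:R^-1 2%:R) mulVf ?scale1r.
have [tE dE] := idempotent_trace_det EE; exists (\rank E).
have ME : M = 1%:M - 2%:R *: E by rewrite E2 opprB addrC subrK.
split; last by rewrite {1}ME.
by rewrite {1}ME mxtraceD mxtrace1 raddfN /= mxtraceZ tE natrM.
Qed.

(** * Determinants on a subspace in dual coordinates *)

Section DualFrames.
Variables (C : fieldType) (vT : vectType C).

(** A basis of [U] with its coordinate forms given separately, as restrictions
of forms on the whole space: for function spaces, evaluations at points. *)
Definition dual_frame (U : {vspace vT}) k (b : 'I_k -> vT)
    (c : 'I_k -> {scalar vT}) : Prop :=
  [/\ forall i, b i \in U,
      forall i j, c j (b i) = (i == j)%:R
    & forall x, x \in U -> x = \sum_j c j x *: b j].

Definition frame_mx k (b : 'I_k -> vT) (c : 'I_k -> {scalar vT})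
    (f : 'End(vT)) : 'M[C]_k := \matrix_(i, j) c j (f (b i)).

Definition stabilizes (U : {vspace vT}) (f : 'End(vT)) : Prop :=
  forall x, x \in U -> f x \in U.

(** The product is in the row convention: [f] acts first and stands left. *)
Lemma frame_mxM U k (b : 'I_k -> vT) c f g :
  dual_frame U b c -> stabilizes U f ->
  frame_mx b c (g \o f) = frame_mx b c f *m frame_mx b c g.
Proof.
move=> [bU _ bc] fU; apply/matrixP=> i j; rewrite !mxE lfunE /=.
rewrite {1}(bc (f (b i)) (fU _ (bU i))) !linear_sum /=.
by apply: eq_bigr => l _; rewrite !mxE !linearZ.
Qed.

Lemma frame_mxZ k (b : 'I_k -> vT) c (a : C) f :
  frame_mx b c (a *: f) = a *: frame_mx b c f.
Proof. by apply/matrixP=> i j; rewrite !mxE lfunE /= linearZ. Qed.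

Lemma frame_mx1 U k (b : 'I_k -> vT) c :
  dual_frame U b c -> frame_mx b c \1 = 1%:M.
Proof. by case=> _ cb _; apply/matrixP=> i j; rewrite !mxE lfunE /= cb. Qed.

Lemma vbasis_frame U :
  dual_frame U (fun i => (vbasis U)`_i) (fun j => coord (vbasis U) j).
Proof.
have fb := basis_free (vbasisP U).
split=> [i|i j|x]; first by rewrite vbasis_mem ?mem_nth ?size_tuple.
  exact: coord_free.
exact: coord_vbasis.
Qed.

Lemma mulmx1_size p q (A : 'M[C]_(p, q)) (D : 'M[C]_(q, p)) :
  A *m D = 1%:M -> D *m A = 1%:M -> p = q.
Proof.
move=> AD DA; apply/eqP; rewrite eqn_leq.
have le r s (X : 'M[C]_(r, s)) Y : X *m Y = 1%:M -> (r <= s)%N.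
  move=> XY; rewrite -(mxrank1 C r) -XY.
  by rewrite (leq_trans (mxrankM_maxl X Y)) ?rank_leq_col.
by rewrite (le _ _ _ _ AD) (le _ _ _ _ DA).
Qed.

(** The change of coordinates [Q] and its inverse [R] are a priori rectangular;
being mutually inverse forces the sizes to agree, and then [Q] and [R]
cancel in the determinant. *)
Lemma frame_change U k1 (b1 : 'I_k1 -> vT) c1 k2 (b2 : 'I_k2 -> vT) c2 :
  dual_frame U b1 c1 -> dual_frame U b2 c2 ->
  k1 = k2 /\ forall f, stabilizes U f ->
    \det (frame_mx b1 c1 f) = \det (frame_mx b2 c2 f).
Proof.
move=> [bU1 cb1 bc1] [bU2 cb2 bc2].
pose Q : 'M_(k1, k2) := \matrix_(i, j) c2 j (b1 i).
pose R : 'M_(k2, k1) := \matrix_(i, j) c1 j (b2 i).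
have QR : Q *m R = 1%:M.
  apply/matrixP=> i j; rewrite !mxE -cb1 (bc2 _ (bU1 i)) linear_sum /=.
  by apply: eq_bigr => l _; rewrite !mxE linearZ.
have RQ : R *m Q = 1%:M.
  apply/matrixP=> i j; rewrite !mxE -cb2 (bc1 _ (bU2 i)) linear_sum /=.
  by apply: eq_bigr => l _; rewrite !mxE linearZ.
have ek := mulmx1_size QR RQ; split=> // f fU.
have -> : frame_mx b1 c1 f = Q *m frame_mx b2 c2 f *m R.
  apply/matrixP=> i j; rewrite !mxE.
  rewrite {1}(bc2 _ (bU1 i)) !linear_sum /=.
  under [RHS]eq_bigr do rewrite mxE mulr_suml.
  rewrite exchange_big; apply: eq_bigr => l _.
  rewrite !linearZ /= (bc2 _ (fU _ (bU2 l))) linear_sum mulr_sumr.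
  by apply: eq_bigr => s _; rewrite !mxE linearZ mulrA.
move: Q R QR RQ; case: _ / ek b2 c2 bU2 cb2 bc2 => b2 c2 _ _ _ Q R QR _.
by rewrite !det_mulmx mulrAC -det_mulmx QR det1 mul1r.
Qed.

End DualFrames.

Section DetOn.
Variables (B : finNzRingType) (C : fieldType) (m : nat).
Local Notation X := (wspace B C m).
Implicit Types (U : {vspace X}) (f g : 'End(X)).

Lemma det_onE U k (b : 'I_k -> X) c f :
  dual_frame U b c -> stabilizes U f -> det_on U f = \det (frame_mx b c f).
Proof.
move=> bc fU; have [_ <- //] := frame_change (vbasis_frame U) bc.
Qed.

Lemma frame_dim U k (b : 'I_k -> X) c : dual_frame U b c -> \dim U = k.
Proof. by case/(frame_change (vbasis_frame U)). Qed.

Lemma det_onM U f g :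
  stabilizes U f -> stabilizes U g ->
  det_on U (g \o f) = det_on U g * det_on U f.
Proof.
move=> fU gU; rewrite mulrC !(det_onE (vbasis_frame U)) //.
  by rewrite (frame_mxM _ (vbasis_frame U)) // det_mulmx.
by move=> x xU; rewrite lfunE /= gU ?fU.
Qed.

Lemma det_onZ U a f : det_on U (a *: f) = a ^+ \dim U * det_on U f.
Proof.
rewrite -detZ; congr (\det _).
by apply/matrixP=> i j; rewrite !mxE lfunE /= linearZ.
Qed.

Lemma det_on1 U : det_on U \1 = 1.
Proof.
rewrite (det_onE (vbasis_frame U)) => [|x]; last by rewrite lfunE.
by rewrite (frame_mx1 (vbasis_frame U)) det1.
Qed.

End DetOn.

(** * Even and odd functions *)

Section Functions.
Variables (B : finNzRingType) (C : fieldType) (m : nat).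
Local Notation X := (wspace B C m).
Local Notation vec := 'cV[B]_m.
Implicit Types (x y : X) (a v w : vec) (f g : 'End(X)).

Definition ev v x : C := (x : {ffun vec -> C^o}) v.

Lemma ev_is_scalar v : scalar (ev v).
Proof. by move=> c x y; rewrite /ev !ffunE. Qed.

HB.instance Definition _ v :=
  GRing.isLinear.Build C X C _ (ev v) (ev_is_scalar v).

Lemma wspaceP x y : (forall v, ev v x = ev v y) -> x = y.
Proof. by move=> exy; apply/ffunP => v; apply: exy. Qed.

Lemma ev_e v a : ev v (e C a) = (v == a)%:R.
Proof. by rewrite /ev ffunE. Qed.

Lemma e_expansion x : x = \sum_a ev a x *: e C a.
Proof.
apply: wspaceP => v; rewrite linear_sum (bigD1 v) //= big1 => [|a /negbTE av].
  by rewrite addr0 linearZ /= ev_e eqxx mulr1.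
by rewrite linearZ /= ev_e eq_sym av mulr0.
Qed.

Lemma eq_on_e f g : (forall a, f (e C a) = g (e C a)) -> f = g.
Proof.
move=> fg; apply/lfunP => x; rewrite [x]e_expansion !linear_sum.
by apply: eq_bigr => a _; rewrite !linearZ /= fg.
Qed.

Lemma ev_lfun f x v : ev v (f x) = \sum_a ev a x * ev v (f (e C a)).
Proof.
by rewrite {1}[x]e_expansion !linear_sum;
  apply: eq_bigr => a _; rewrite !linearZ.
Qed.

Lemma ev_reflection v x : ev v (reflection B C m x) = ev (- v) x.
Proof.
rewrite ev_lfun (bigD1 (- v)) //= big1 => [|a ne]; rewrite on_basisE ev_e.
  by rewrite opprK eqxx mulr1 addr0.
by rewrite -eqr_oppLR eq_sym (negbTE ne) mulr0.
Qed.

Lemma X_plusP x : reflect (forall v, ev (- v) x = ev v x) (x \in X_plus B C m).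
Proof.
rewrite memv_ker add_lfunE opp_lfunE id_lfunE subr_eq0; apply: (iffP eqP) => [xx v|xx].
  by rewrite -ev_reflection xx.
by apply: wspaceP => v; rewrite ev_reflection.
Qed.

Lemma X_minusP x :
  reflect (forall v, ev (- v) x = - ev v x) (x \in X_minus B C m).
Proof.
rewrite memv_ker add_lfunE id_lfunE addr_eq0; apply: (iffP eqP) => [xx v|xx].
  by rewrite -ev_reflection xx linearN.
by apply: wspaceP => v; rewrite ev_reflection linearN.
Qed.

(** Commuting with the reflection, expressed on the kernel of [f]. *)
Definition even_op f : Prop :=
  forall a b, ev (- b) (f (e C (- a))) = ev b (f (e C a)).

Lemma ev_even_op f x v :
  even_op f -> ev (- v) (f x) = \sum_a ev (- a) x * ev v (f (e C a)).
Proof.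
move=> ef; rewrite ev_lfun (reindex_inj oppr_inj).
by apply: eq_bigr => a _; rewrite ef.
Qed.

Lemma even_opZ c f : even_op f -> even_op (c *: f).
Proof. by move=> ef a b; rewrite !scale_lfunE !linearZ /= ef. Qed.

Lemma even_stab_plus f : even_op f -> stabilizes (X_plus B C m) f.
Proof.
move=> ef x /X_plusP xx; apply/X_plusP => v.
by rewrite ev_even_op // ev_lfun; apply: eq_bigr => a _; rewrite xx.
Qed.

Lemma even_stab_minus f : even_op f -> stabilizes (X_minus B C m) f.
Proof.
move=> ef x /X_minusP xx; apply/X_minusP => v.
rewrite ev_even_op // ev_lfun -sumrN.
by apply: eq_bigr => a _; rewrite xx mulNr.
Qed.

End Functions.

(** * The bases of the even and odd functions given by a half system *)

Section HalfSystem.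
Variables (B : finNzRingType) (C : fieldType) (m : nat).
Variable I : {set 'cV[B]_m}.
Hypothesis no2 : forall v : 'cV[B]_m, - v = v -> v = 0.
Hypothesis hI : half_system I.
Hypothesis two_neq0 : 2%:R != 0 :> C.
Local Notation X := (wspace B C m).
Local Notation vec := 'cV[B]_m.
Local Notation d := #|I|.

Lemma half_system0 : 0 \notin I.
Proof. by case: hI. Qed.

Lemma half_systemN v : v != 0 -> (- v \in I) = (v \notin I).
Proof.
move=> v0; have vN : v != - v.
  by apply: contra v0 => /eqP vv; rewrite (no2 (esym vv)).
case: hI => _ /(_ v v0); rewrite setIUr.
have s1 w : I :&: [set w] = if w \in I then [set w] else set0.
  apply/setP => y; rewrite !inE; case: ifP => wI; rewrite !inE andbC.
    by case: eqP => // ->.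
  by case: eqP => // ->.
rewrite !s1; case: ifP; case: ifP; rewrite ?set0U ?setU0 ?cards0 ?cards1 //.
by rewrite cards2 vN.
Qed.

Lemma half_system_neq0 v : v \in I -> v != 0.
Proof. by apply: contraTneq => ->; apply: half_system0. Qed.

Lemma half_system_opp v : v \in I -> - v \notin I.
Proof. by move=> vI; rewrite half_systemN ?vI // half_system_neq0. Qed.

Lemma sum_half_system (V : nmodType) (F : vec -> V) :
  \sum_v F v = F 0 + \sum_(v in I) (F v + F (- v)).
Proof.
rewrite (bigD1 0) //=; congr (_ + _).
rewrite (bigID (mem I)) big_split /=; congr (_ + _).
  apply: eq_bigl => v.
  by case: (boolP (v \in I)) => [/half_system_neq0 -> //|]; rewrite andbF.
rewrite (reindex_inj oppr_inj) /=; apply: eq_bigl => v.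
rewrite oppr_eq0; case: eqP => [->|/eqP v0] /=; first by rewrite (negbTE half_system0).
by rewrite half_systemN // negbK.
Qed.

Lemma card_half_system : #|{: vec}| = (1 + 2 * d)%N.
Proof.
have -> : #|{: vec}| = \sum_(v : vec) 1 by rewrite sum1_card.
by rewrite sum_half_system /= -[in RHS]sum1_card big_distrr.
Qed.

Lemma sum_I_delta (F : vec -> C) y :
  \sum_(v in I) F v * (y == v)%:R = if y \in I then F y else 0.
Proof.
case: ifP => yI; last first.
  by apply: big1 => v vI; case: eqP yI => [->|]; rewrite ?vI ?mulr0.
rewrite (bigD1 y) //= big1 => [|v /andP[_ /negbTE vy]].
  by rewrite eqxx mulr1 addr0.
by rewrite eq_sym vy mulr0.
Qed.

Lemma enum_valN (i j : 'I_d) : (enum_val j == - enum_val i) = false.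
Proof.
apply: contraNF (half_system_opp (enum_valP i)) => /eqP <-; exact: enum_valP.
Qed.

Definition minus_vec (i : 'I_d) : X := e C (enum_val i) - e C (- enum_val i).

Definition minus_coord (i : 'I_d) : {scalar X} := ev (enum_val i).

Lemma minus_frame : dual_frame (X_minus B C m) minus_vec minus_coord.
Proof.
split=> [i|i j|x /X_minusP xx].
- by apply/X_minusP => v; rewrite !linearB /= !ev_e eqr_opp eqr_oppLR opprB.
- rewrite linearB /= !ev_e (inj_eq enum_val_inj) eq_sym enum_valN subr0 //.
(* compare the values at 0, at a point of I, at a point of -I *)
apply: wspaceP => y; rewrite linear_sum /=.
under eq_bigr do rewrite linearZ linearB /= !ev_e /minus_coord /=.
rewrite -(big_enum_val (fun v => ev v x * ((y == v)%:R - (y == - v)%:R))) /=.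
under eq_bigr do rewrite -eqr_oppLR mulrBr.
rewrite sumrB !(sum_I_delta (fun v => ev v x)).
have [->|y0] := eqVneq y 0.
  (* an odd function vanishes at 0 *)
  rewrite oppr0 (negbTE half_system0) subrr; apply/eqP.
  have := xx 0; rewrite oppr0 => /eqP.
  by rewrite -addr_eq0 -mulr2n -mulr_natl mulf_eq0 (negbTE two_neq0).
rewrite half_systemN //; case: ifP => /= yI; first by rewrite subr0.
by rewrite sub0r xx opprK.
Qed.

Definition plus_vec (i : 'I_(1 + d)) : X :=
  if split i is inr j then e C (enum_val j) + e C (- enum_val j) else e C 0.

Definition plus_coord (i : 'I_(1 + d)) : {scalar X} :=
  ev (if split i is inr j then enum_val j else 0).

Lemma plus_vecl i : plus_vec (lshift d i) = e C 0.
Proof. by rewrite /plus_vec -[lshift _ _]/(unsplit (inl i)) unsplitK. Qed.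

Lemma plus_vecr j :
  plus_vec (rshift 1 j) = e C (enum_val j) + e C (- enum_val j).
Proof. by rewrite /plus_vec -[rshift _ _]/(unsplit (inr j)) unsplitK. Qed.

Lemma plus_coordl i x : plus_coord (lshift d i) x = ev 0 x.
Proof. by rewrite /plus_coord -[lshift _ _]/(unsplit (inl i)) unsplitK. Qed.

Lemma plus_coordr j x : plus_coord (rshift 1 j) x = ev (enum_val j) x.
Proof. by rewrite /plus_coord -[rshift _ _]/(unsplit (inr j)) unsplitK. Qed.

Lemma plus_frame : dual_frame (X_plus B C m) plus_vec plus_coord.
Proof.
have enum_val0 (j : 'I_d) : (enum_val j == 0) = false.
  exact: negbTE (half_system_neq0 (enum_valP j)).
split=> [i|i j|x /X_plusP xx].
- apply/X_plusP => v; case: (split_ordP i) => j ->.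
    by rewrite plus_vecl !ev_e oppr_eq0.
  by rewrite plus_vecr !linearD /= !ev_e eqr_opp eqr_oppLR addrC.
- case: (split_ordP i) => i' ->; case: (split_ordP j) => j' ->;
    rewrite ?plus_vecl ?plus_vecr ?plus_coordl ?plus_coordr
            ?linearD /= !ev_e ?eq_lshift ?eq_rshift ?eq_lrshift ?eq_rlshift.
  + by rewrite eqxx !ord1.
  + by rewrite enum_val0.
  + by rewrite -eqr_oppLR oppr0 eq_sym enum_val0 addr0.
  + by rewrite (inj_eq enum_val_inj) eq_sym enum_valN addr0.
apply: wspaceP => y; rewrite linear_sum big_split_ord big_ord1 /=.
rewrite plus_coordl plus_vecl linearZ /= ev_e.
under eq_bigr do rewrite plus_coordr plus_vecr linearZ linearD /= !ev_e.
rewrite -(big_enum_val (fun v => ev v x * ((y == v)%:R + (y == - v)%:R))) /=.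
under eq_bigr do rewrite -eqr_oppLR mulrDr.
rewrite big_split !(sum_I_delta (fun v => ev v x)) /=.
have [->|y0] := eqVneq y 0.
  by rewrite oppr0 (negbTE half_system0) mulr1 !addr0.
rewrite mulr0 add0r half_systemN //; case: ifP => /= yI; first by rewrite addr0.
by rewrite add0r xx.
Qed.

Lemma dim_X_plus : \dim (X_plus B C m) = (\dim (X_minus B C m)).+1.
Proof. by rewrite (frame_dim plus_frame) (frame_dim minus_frame). Qed.

Lemma minus_mxE f i j :
  frame_mx minus_vec minus_coord f i j =
  ev (enum_val j) (f (e C (enum_val i))) - ev (enum_val j) (f (e C (- enum_val i))).
Proof. by rewrite mxE !linearB. Qed.

(** The matrix of [f] on even functions modulo the line of [e_0]. *)
Definition even_mx f : 'M[C]_d :=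
  \matrix_(i, j) (ev (enum_val j) (f (e C (enum_val i)))
                  + ev (enum_val j) (f (e C (- enum_val i)))).

Lemma plus_mxE f :
  frame_mx plus_vec plus_coord f =
  block_mx (ev 0 (f (e C 0)))%:M (\row_j ev (enum_val j) (f (e C 0)))
    (\col_i (ev 0 (f (e C (enum_val i))) + ev 0 (f (e C (- enum_val i)))))
    (even_mx f).
Proof.
apply/matrixP => i j; rewrite mxE.
case: (split_ordP i) => i' ->; case: (split_ordP j) => j' ->;
  rewrite ?block_mxEul ?block_mxEur ?block_mxEdl ?block_mxEdr ?mxE
    ?plus_vecl ?plus_vecr ?plus_coordl ?plus_coordr ?linearD //.
by rewrite !ord1 mulr1n.
Qed.

End HalfSystem.

(** * The normalizing factor *)

Section CFactor.
Variables (B : finNzRingType) (C : fieldType) (m : nat).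
Variable I : {set 'cV[B]_m}.
Hypothesis no2 : forall v : 'cV[B]_m, - v = v -> v = 0.
Hypothesis hI : half_system I.
Hypothesis two_neq0 : 2%:R != 0 :> C.
Local Notation X := (wspace B C m).
Implicit Types f g : 'End(X).

Lemma det_on_neq0 f g U :
  stabilizes U f -> stabilizes U g -> (g \o f)%VF = \1%VF -> det_on U f != 0.
Proof.
move=> fU gU gf; apply: contra_eq_neq (det_onM fU gU) => ->.
by rewrite gf mulr0 det_on1 oner_neq0.
Qed.

(** The exponents of the scalar in the two determinants differ by one, since
[dim X_+ = dim X_- + 1]. *)
Lemma c_factorZ a f : a != 0 -> c_factor (a *: f) = a^-1 * c_factor f.
Proof.
move=> a0; rewrite /c_factor !det_onZ (dim_X_plus no2 hI two_neq0) exprSr invfM.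
rewrite invfM mulrACA; congr (_ * _); rewrite mulrAC mulVf ?mul1r //.
by rewrite expf_neq0.
Qed.

(** Conjugate operators have equal determinants on each of [X_+] and [X_-]. *)
Lemma c_factor_conj h f g :
  even_op h -> even_op f -> even_op g ->
  det_on (X_plus B C m) h != 0 -> det_on (X_minus B C m) h != 0 ->
  (h \o f = g \o h)%VF -> c_factor f = c_factor g.
Proof.
move=> eh ef eg hp hm hfg; rewrite /c_factor.
have det_eq U : stabilizes U h -> stabilizes U f -> stabilizes U g ->
    det_on U h != 0 -> det_on U f = det_on U g.
  move=> Uh Uf Ug h0; apply: (mulfI h0).
  by rewrite -det_onM // hfg det_onM // mulrC.
by rewrite !det_eq //; (apply: even_stab_plus || apply: even_stab_minus).
Qed.

(** The last hypothesis says that the matrix of [f] on odd functions is [diag s]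
times its matrix on even functions modulo [e_0]. The latter is invertible, as
[g] inverts [f], and cancels in the quotient. *)
Lemma c_factor_signs f g (s : 'cV[B]_m -> C) :
  even_op f -> even_op g -> (g \o f)%VF = \1%VF -> f (e C 0) = e C 0 ->
  (forall v w, v \in I -> w \in I ->
     ev w (f (e C v)) - ev w (f (e C (- v)))
     = s v * (ev w (f (e C v)) + ev w (f (e C (- v))))) ->
  c_factor f = \prod_(v in I) s v.
Proof.
move=> ef eg gf f0 fs; rewrite /c_factor.
have := det_on_neq0 (even_stab_plus ef) (even_stab_plus eg) gf.
rewrite (det_onE (plus_frame C no2 hI) (even_stab_plus ef)).
rewrite (det_onE (minus_frame no2 hI two_neq0) (even_stab_minus ef)).
rewrite plus_mxE f0 ev_e eqxx.
have -> : \row_j ev (enum_val j) (e C 0) = 0 :> 'rV[C]_#|I|.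
  apply/rowP => j; rewrite !mxE ev_e.
  by rewrite (negbTE (half_system_neq0 hI (enum_valP j))).
rewrite det_lblock det1 mul1r.
have -> : frame_mx (@minus_vec B C m I) (@minus_coord B C m I) f
        = diag_mx (\row_i s (enum_val i)) *m even_mx I f.
  apply/matrixP => i j; rewrite minus_mxE mul_diag_mx !mxE.
  by rewrite fs ?enum_valP.
rewrite det_mulmx det_diag mulrCA => M0; rewrite mulVf // mulr1.
by rewrite [RHS]big_enum_val /=; apply: eq_bigr => i _; rewrite mxE.
Qed.

End CFactor.

Section BasisOperators.
Variables (B : finNzRingType) (C : fieldType) (m : nat).
Local Notation X := (wspace B C m).

Definition mx_op (Y : 'M[B]_m) : 'End(X) := on_basis (fun a => e C (Y *m a)).

Definition mult_op (phi : 'cV[B]_m -> C) : 'End(X) :=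
  on_basis (fun a => phi a *: e C a).

Lemma mx_opE Y a : mx_op Y (e C a) = e C (Y *m a).
Proof. exact: on_basisE. Qed.

Lemma mult_opE phi a : mult_op phi (e C a) = phi a *: e C a.
Proof. exact: on_basisE. Qed.

Lemma mx_op_even Y : even_op (mx_op Y).
Proof. by move=> a b; rewrite !mx_opE mulmxN !ev_e eqr_opp. Qed.

Lemma mult_op_even phi : (forall a, phi (- a) = phi a) -> even_op (mult_op phi).
Proof. by move=> ephi a b; rewrite !mult_opE !linearZ /= !ev_e eqr_opp ephi. Qed.

Lemma mx_op_comp Y Z : Z *m Y = 1%:M -> (mx_op Z \o mx_op Y)%VF = \1%VF.
Proof.
move=> ZY; apply: eq_on_e => a.
by rewrite comp_lfunE !mx_opE mulmxA ZY mul1mx id_lfunE.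
Qed.

Lemma mult_op_comp phi psi :
  (forall a, psi a * phi a = 1) -> (mult_op psi \o mult_op phi)%VF = \1%VF.
Proof.
move=> pp; apply: eq_on_e => a.
rewrite comp_lfunE !mult_opE linearZ /= mult_opE scalerA mulrC pp.
by rewrite scale1r id_lfunE.
Qed.

Variable I : {set 'cV[B]_m}.
Hypothesis no2 : forall v : 'cV[B]_m, - v = v -> v = 0.
Hypothesis hI : half_system I.
Hypothesis two_neq0 : 2%:R != 0 :> C.

(** The sign at [v] tells whether [Y] takes [v] into [I] or into [-I], which is
what [mu] counts. *)
Lemma c_factor_mx_op Y : GL_mx Y -> c_factor (mx_op Y) = mu C I Y.
Proof.
move=> /existsP[Z /andP[/eqP YZ /eqP ZY]].
have mem_opp v : (v \in [set - w | w in I]) = (- v \in I).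
  apply/imsetP/idP => [[w wI ->]|vI]; first by rewrite opprK.
  by exists (- v); rewrite ?opprK.
rewrite (c_factor_signs no2 hI two_neq0
           (s := fun v => (-1) ^+ (Y *m v \in [set - w | w in I]))
           (mx_op_even Y) (mx_op_even Z) (mx_op_comp ZY)).
- rewrite -expr_sum /mu; congr (_ ^+ _).
  rewrite -[RHS]sum1_card [RHS](eq_bigl _ _ (fun v => in_set _ v)).
  by rewrite [RHS]big_mkcondr; apply: eq_bigr => v _; case: (_ \in _).
- by rewrite mx_opE mulmx0.
move=> v w vI wI; rewrite !mx_opE mulmxN !ev_e mem_opp.
have Yv0 : Y *m v != 0.
  apply: contra_neq (half_system_neq0 hI vI) => Yv.
  by rewrite -[v]mul1mx -ZY -mulmxA Yv mulmx0.
case: (boolP (- (Y *m v) \in I)) => YvI.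
  have /negbTE -> : w != Y *m v.
    by apply: contraTneq wI => ->; rewrite -(half_systemN no2 hI).
  by rewrite expr1 sub0r add0r mulN1r.
have /negbTE -> : w != - (Y *m v) by apply: contraTneq wI => ->.
by rewrite expr0 subr0 addr0 mul1r.
Qed.

Lemma c_factor_mult_op phi :
  phi 0 = 1 -> (forall a, phi a != 0) -> (forall a, phi (- a) = phi a) ->
  c_factor (mult_op phi) = 1.
Proof.
move=> phi0 phin0 ephi.
have eV a : (phi (- a))^-1 = (phi a)^-1 by rewrite ephi.
rewrite (c_factor_signs no2 hI two_neq0 (s := fun=> 1)
  (mult_op_even ephi) (mult_op_even (phi := fun a => (phi a)^-1) eV)).
- by rewrite big1.
- by apply: mult_op_comp => a; rewrite mulVf.
- by rewrite mult_opE phi0 scale1r.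
move=> v w vI wI; rewrite !mult_opE !linearZ /= !ev_e mul1r.
have /negbTE -> : w != - v.
  by apply: contraTneq wI => ->; apply: half_system_opp.
by rewrite mulr0 subr0 addr0.
Qed.

End BasisOperators.

(** * The pairing of B^m and its Fourier operator *)

Section Pairing.
Variables (B : finUnitRingType) (star : involution B) (C : fieldType).
Variables (beta : B -> C).
Hypothesis two_unit : 2%:R \is a @GRing.unit B.
Hypothesis beta_char : add_char beta.
Hypothesis beta_prim : primitive beta.
Hypothesis beta_star : forall b, beta (b + star b) = 1.

Lemma betaD x y : beta (x + y) = beta x * beta y.
Proof. by case: beta_char => _; apply. Qed.

Lemma beta_neq0 x : beta x != 0.
Proof. by case: beta_char. Qed.

Lemma beta0 : beta 0 = 1.
Proof. by apply: (mulfI (beta_neq0 0)); rewrite -betaD addr0 mulr1. Qed.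

Lemma betaN x : beta (- x) = (beta x)^-1.
Proof.
by apply: (mulfI (beta_neq0 x)); rewrite -betaD subrr beta0 divff ?beta_neq0.
Qed.

Lemma beta_starE x : beta (star x) = (beta x)^-1.
Proof.
by apply: (mulfI (beta_neq0 x)); rewrite -betaD beta_star divff ?beta_neq0.
Qed.

Section Dimension.
Variable m : nat.
Local Notation vec := 'cV[B]_m.
Implicit Types (a b v w u : vec) (T : 'M[B]_m).

Lemma opp_eq_vec0 v : - v = v -> v = 0.
Proof.
move=> vv; have v2 : v + v = 0 by rewrite -{1}vv addNr.
apply/colP => i; rewrite mxE; apply: (mulrI two_unit).
by rewrite mulr0 mulr_natl mulr2n; have /colP/(_ i) := v2; rewrite !mxE.
Qed.

Definition dot a b : B := (star_mx star a *m b) 0 0.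

Lemma dotDl a b c : dot (a + b) c = dot a c + dot b c.
Proof.
have starD : star_mx star (a + b) = star_mx star a + star_mx star b.
  by apply/matrixP => i j; rewrite !mxE inv_add.
by rewrite /dot starD mulmxDl mxE.
Qed.

Lemma dotDr a b c : dot a (b + c) = dot a b + dot a c.
Proof. by rewrite /dot mulmxDr mxE. Qed.

Lemma dot0l b : dot 0 b = 0.
Proof. by rewrite /dot star_mx0 mul0mx mxE. Qed.

Lemma dot0r a : dot a 0 = 0.
Proof. by rewrite /dot mulmx0 mxE. Qed.

Lemma dotNl a b : dot (- a) b = - dot a b.
Proof. by apply/eqP; rewrite -addr_eq0 -dotDl addNr dot0l. Qed.

Lemma dotNr a b : dot a (- b) = - dot a b.
Proof. by apply/eqP; rewrite -addr_eq0 -dotDr addNr dot0r. Qed.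

Lemma star_dot a b : star (dot a b) = dot b a.
Proof.
rewrite /dot -{2}(star_mxK star a) -star_mxM.
by rewrite [in RHS]/star_mx [RHS]mxE [RHS]mxE.
Qed.

Lemma dot_mull T a b : dot (T *m a) b = dot a (star_mx star T *m b).
Proof. by rewrite /dot star_mxM mulmxA. Qed.

Lemma beta_dotC a b : beta (dot b a) = (beta (dot a b))^-1.
Proof. by rewrite -star_dot beta_starE. Qed.

Definition chi a b : C := beta (2%:R * dot a b).

(** Reduces identities between values of [chi] and [beta] to field identities
in the nonzero numbers [beta (dot a b)]. *)
Lemma chi_sq a b : chi a b = beta (dot a b) ^+ 2.
Proof. by rewrite /chi mulr_natl mulr2n betaD expr2. Qed.

Lemma chiDl a b c : chi (a + b) c = chi a c * chi b c.
Proof. by rewrite /chi dotDl mulrDr betaD. Qed.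

Lemma chiDr a b c : chi a (b + c) = chi a b * chi a c.
Proof. by rewrite /chi dotDr mulrDr betaD. Qed.

Lemma chiNl a b : chi (- a) b = (chi a b)^-1.
Proof. by rewrite /chi dotNl mulrN betaN. Qed.

Lemma chiNr a b : chi a (- b) = (chi a b)^-1.
Proof. by rewrite /chi dotNr mulrN betaN. Qed.

Lemma chi0r a : chi a 0 = 1.
Proof. by rewrite /chi dot0r mulr0 beta0. Qed.

Lemma chiC a b : chi b a = (chi a b)^-1.
Proof. by rewrite !chi_sq beta_dotC exprVn. Qed.

(** [a^* a] is fixed by the involution, so twice it has the form [x + x^*]. *)
Lemma chi_diag a : chi a a = 1.
Proof. by rewrite /chi mulr_natl mulr2n -{2}(star_dot a a) beta_star. Qed.

(** If [c] is in the radical, [beta] is trivial on the right ideal generated by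
each [(c_i)^*]: the star comes from moving [c] to the left of the pairing,
where entries are multiplied on the right. *)
Lemma chi_nondeg c : (forall u, chi u c = 1) -> c = 0.
Proof.
move=> chic; apply/colP => i; rewrite mxE.
pose K := [set star (c i 0) * b | b : B].
suff : star (c i 0) \in [set (0 : B)].
  by rewrite inE => /eqP ci; rewrite -(inv_invol star (c i 0)) ci Defs.inv0.
rewrite -(_ : K = [set 0]); first by apply/imsetP; exists 1; rewrite ?mulr1.
apply: beta_prim => [|_ /imsetP[b _ ->]].
  split=> [|x y /imsetP[b _ ->] /imsetP[b' _ ->]|x b' /imsetP[b _ ->]].
  - by apply/imsetP; exists 0; rewrite ?mulr0.
  - by apply/imsetP; exists (b - b'); rewrite ?mulrBr.
  - by apply/imsetP; exists (b * b'); rewrite ?mulrA.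
pose u : vec := \col_j (if j == i then 2%:R^-1 * b else 0).
have := chic u; rewrite chiC => /(canRL (@invrK _)); rewrite invr1 => <-.
congr beta; rewrite /dot mxE (bigD1 i) //= big1 => [|j /negbTE ji].
  rewrite !mxE eqxx addr0 mulr_natl -mulrnAr; congr (_ * _).
  by rewrite -mulr_natl mulrA divrr ?mul1r.
by rewrite !mxE ji mulr0.
Qed.

Lemma sum_chi c : \sum_b chi b c = if c == 0 then #|{: vec}|%:R else 0.
Proof.
case: eqP => [->|c0].
  by under eq_bigr do rewrite chi0r; rewrite sumr_const.
have [u chiu] : exists u, chi u c != 1.
  apply/existsP; apply: contra_notT c0 => /existsPn chic.
  by apply: chi_nondeg => u; apply/eqP; have := chic u; rewrite negbK.
(* translation by u multiplies the sum by chi u c, which is not 1 *)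
have : (chi u c - 1) * \sum_b chi b c = 0.
  rewrite mulrBl mul1r mulr_sumr [X in _ - X](reindex_inj (addrI u)).
  by under [X in _ - X]eq_bigr do rewrite chiDl; rewrite subrr.
by move/eqP; rewrite mulf_eq0 subr_eq0 (negbTE chiu) => /eqP.
Qed.

Local Notation X := (wspace B C m).

Definition fourier : 'End(X) := on_basis (fun a => \sum_b chi a b *: e C b).

Lemma fourierE a : fourier (e C a) = \sum_b chi a b *: e C b.
Proof. exact: on_basisE. Qed.

Lemma ev_fourier a b : ev b (fourier (e C a)) = chi a b.
Proof.
rewrite fourierE linear_sum (bigD1 b) //= big1 => [|c /negbTE cb].
  by rewrite linearZ /= ev_e eqxx mulr1 addr0.
by rewrite linearZ /= ev_e eq_sym cb mulr0.
Qed.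

Lemma fourier_even : even_op fourier.
Proof. by move=> a b; rewrite !ev_fourier chiNl chiNr invrK. Qed.

(** The pairing being skew, the square is a multiple of the identity and not, as
for a symmetric pairing, of the reflection. *)
Lemma fourier_sq : (fourier \o fourier)%VF = #|{: vec}|%:R *: \1%VF.
Proof.
apply: eq_on_e => a; rewrite comp_lfunE scale_lfunE id_lfunE.
apply: wspaceP => c; rewrite ev_lfun linearZ /= ev_e.
under eq_bigr do rewrite !ev_fourier (chiC _ a) -chiNr mulrC -chiDr.
by rewrite sum_chi subr_eq0; case: eqP; rewrite ?mulr1 ?mulr0.
Qed.

Lemma fourier_inv : #|{: vec}|%:R != 0 :> C ->
  ((#|{: vec}|%:R^-1 *: fourier) \o fourier = \1)%VF.
Proof.
by move=> q0; rewrite -comp_lfunZl fourier_sq scalerA mulVf // scale1r.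
Qed.

(** As [chi (Y a) b = chi a (Y^* b)], permuting the points by [Y] becomes, after
Fourier, composing functions with [Y^*], that is permuting the points by its
inverse [Z]. *)
Lemma fourier_mx_op Y Z : Z *m star_mx star Y = 1%:M ->
  star_mx star Y *m Z = 1%:M ->
  (fourier \o mx_op C Y = mx_op C Z \o fourier)%VF.
Proof.
move=> ZY YZ; apply: eq_on_e => a; rewrite !comp_lfunE mx_opE.
apply: wspaceP => c; rewrite ev_fourier fourierE !linear_sum /=.
rewrite (bigD1 (star_mx star Y *m c)) //= big1 => [|b /negbTE cb].
  rewrite !linearZ /= mx_opE ev_e mulmxA ZY mul1mx eqxx mulr1 addr0.
  by rewrite /chi dot_mull.
rewrite !linearZ /= mx_opE ev_e -{1}[c]mul1mx -ZY -mulmxA.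
case: eqP => [Zcb|]; last by rewrite mulr0.
have := congr1 (mulmx (star_mx star Y)) Zcb.
by rewrite mulmxA YZ !mulmxA YZ !mul1mx => cb'; rewrite cb' eqxx in cb.
Qed.

End Dimension.

End Pairing.

(** * The Heisenberg group and its intertwiners *)

Section Heisenberg.
Variables (B : finUnitRingType) (star : involution B) (C : fieldType).
Variables (beta : B -> C) (m : nat).
Hypothesis two_unit : 2%:R \is a @GRing.unit B.
Hypothesis beta_char : add_char beta.
Hypothesis beta_prim : primitive beta.
Hypothesis beta_star : forall b, beta (b + star b) = 1.
Local Notation X := (wspace B C m).
Local Notation dot := (dot star).
Local Notation chi := (chi star beta).
Local Notation fourier := (fourier star beta m).
Variable Sch : heis B m -> 'End(X).
Hypothesis hS : schrodinger star beta Sch.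

Lemma herm_col (u w u' w' : 'cV[B]_m) :
  herm star (col_mx u w) (col_mx u' w') = dot u w' + dot w u'.
Proof.
have star_col : star_mx star (col_mx u w)
              = row_mx (star_mx star u) (star_mx star w).
  by rewrite /star_mx map_col_mx tr_col_mx.
rewrite /herm star_col mul_row_block !mulmx0 !mulmx1 add0r addr0.
by rewrite mul_row_col mxE addrC.
Qed.

(** The relations of a Schrodinger representation determine it: the element
[(b, u + w)] factors as [(b - h(w, u), 0)], then [w] in [N], then [u] in
[M]. *)
Lemma schrodingerE b (u w v : 'cV[B]_m) :
  Sch (b, col_mx u w) (e C v) =
  (beta b * chi u v * beta (dot u w)) *: e C (v + w).
Proof.
case: hS => _ SM Sb Sw Su.
have -> : (b, col_mx u w) = heis_mul star (b - dot w u, 0)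
            (heis_mul star (0, in_N w) (0, in_M u)).
  rewrite /heis_mul /in_N /in_M /= herm_col dot0l // add0r !add0r.
  rewrite -[0 : 'cV_(m + m)]col_mx0 add_col_mx herm_col !dot0l !addr0 !add0r.
  by rewrite subrK.
rewrite !SM !comp_lfunE Su linearZ /= Sw linearZ /= Sb scalerA.
rewrite /in_M /in_N herm_col dot0l addr0; congr (_ *: _).
rewrite betaD // betaN // (beta_dotC beta_char beta_star u w) invrK.
by rewrite mulrCA mulrA.
Qed.

(** Commuting with [M] keeps the line of [e_0], as the characters [chi u]
separate points; commuting with [N] carries the scalar from [e_0] to every [e_v]. *)
Lemma schrodinger_schur (Z : 'End(X)) :
  (forall k, (Z \o Sch k = Sch k \o Z)%VF) -> exists c, Z = c *: \1%VF.
Proof.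
move=> ZS.
have Z0 v : v != 0 -> ev v (Z (e C 0)) = 0.
  move=> v0.
  have [u chiu] : exists u, chi u v != 1.
    apply/existsP; apply: contraNT v0 => /existsPn chic; apply/eqP.
    by apply: (chi_nondeg two_unit beta_char beta_prim beta_star) => u;
      apply/eqP; have := chic u; rewrite negbK.
  have := congr1 (ev v)
    (congr1 (fun f : 'End(X) => f (e C 0)) (ZS (0, col_mx u 0))).
  rewrite !comp_lfunE schrodingerE chi0r // dot0r beta0 // !mulr1 addr0 scale1r.
  rewrite [RHS]ev_lfun (bigD1 v) //= big1 => [|a /negbTE av].
    rewrite schrodingerE dot0r beta0 // mul1r mulr1 addr0 linearZ /= ev_e.
    rewrite addr0 eqxx mulr1 => /eqP; rewrite -subr_eq0 -{1}[ev v _]mulr1 -mulrBr.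
    by rewrite mulf_eq0 subr_eq0 (eq_sym 1) (negbTE chiu) orbF => /eqP.
  by rewrite schrodingerE linearZ /= ev_e addr0 eq_sym av !mulr0.
pose c := ev 0 (Z (e C 0)); exists c; apply: eq_on_e => v.
have e0 : Z (e C 0) = c *: e C 0.
  apply: wspaceP => w; rewrite linearZ /= ev_e.
  by have [->|w0] := eqVneq w 0; [rewrite mulr1 | rewrite mulr0 Z0].
have := congr1 (fun f : 'End(X) => f (e C 0)) (ZS (0, col_mx 0 v)).
rewrite !comp_lfunE e0 linearZ /= !schrodingerE /chi !dot0l mulr0 beta0 //.
by rewrite !mulr1 add0r scale1r scale_lfunE id_lfunE.
Qed.

Lemma intertwiner_uniq g (P Q : 'End(X)) :
  intertwiner Sch (g : SLplus star m) P -> intertwiner Sch g Q ->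
  exists2 c, c != 0 & Q = c *: P.
Proof.
move=> [P0 PS] [Q0 QS].
have QSk k : (Q \o Sch k = Sch (heis_act g k) \o Q)%VF.
  by rewrite -QS -comp_lfunA lker0_compVf // comp_lfun1r.
have SkP k : (Sch k \o P^-1 = P^-1 \o Sch (heis_act g k))%VF.
  by rewrite -PS -comp_lfunA lker0_compKf.
have [k|c Zc] := schrodinger_schur (Z := (P^-1 \o Q)%VF).
  by rewrite -comp_lfunA QSk comp_lfunA -SkP comp_lfunA.
have QP : Q = c *: P.
  by rewrite -(lker0_compVKf P0 Q) Zc -comp_lfunZr comp_lfun1r.
exists c => //; apply: contraTneq Q0 => c0.
rewrite QP c0 scale0r; apply/lker0P => inj0.
have := congr1 (ev 0) (inj0 (e C 0) 0 _).
rewrite !lfunE !linear0 ev_e eqxx => /(_ erefl) /eqP.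
exact/negP/oner_neq0.
Qed.

Lemma intertwinerP (g : SLplus star m) (P Q : 'End(X)) :
  (Q \o P = \1)%VF ->
  (forall b u w v,
     P (Sch (b, col_mx u w) (e C v))
     = Sch (b, val g *m col_mx u w) (P (e C v))) ->
  intertwiner Sch g P.
Proof.
move=> QP PS; have P0 : lker P == 0%VS.
  apply/lker0P; apply: (can_inj (g := Q)) => x.
  by rewrite -comp_lfunE QP id_lfunE.
split=> // -[b x].
have -> : (P \o Sch (b, x) = Sch (heis_act g (b, x)) \o P)%VF.
  apply: eq_on_e => v; rewrite !comp_lfunE /heis_act /=.
  by rewrite -[x]vsubmxK PS.
by rewrite -comp_lfunA lker0_compfV // comp_lfun1r.
Qed.

Lemma mx_op_intertwiner (T : 'M[B]_m) (hT : GL_mx T) :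
  intertwiner Sch (bruhat_h star hT) (mx_op C (inv_mx (star_mx star T))).
Proof.
have /andP[/eqP TT' /eqP T'T] := inv_mxP (star_GL_mx star hT).
apply: intertwinerP (mx_op_comp C TT') _ => b u w v /=.
rewrite /h_mx mul_block_col !mul0mx addr0 add0r schrodingerE linearZ /= !mx_opE.
rewrite schrodingerE -mulmxDr /chi !dot_mull !mulmxA.
by rewrite TT' !mul1mx.
Qed.

(** The second-degree character of [B^m] attached to the skew form [S]. *)
Definition skew_char (S : 'M[B]_m) (a : 'cV[B]_m) : C := beta (- dot a (S *m a)).

Lemma skew_charN S a : skew_char S (- a) = skew_char S a.
Proof. by rewrite /skew_char mulmxN dotNl dotNr opprK. Qed.

Lemma mult_op_intertwiner (S : 'M[B]_m) (hSk : star_mx star S = - S) :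
  intertwiner Sch (bruhat_u hSk) (mult_op (skew_char S)).
Proof.
have SS : (mult_op (fun a => (skew_char S a)^-1%R) \o mult_op (skew_char S) = \1)%VF.
  by apply: mult_op_comp => a; rewrite mulVf // beta_neq0.
apply: intertwinerP SS _ => b u w v /=.
rewrite /u_mx mul_block_col !mul0mx !mul1mx add0r schrodingerE linearZ /= !mult_opE.
rewrite [in RHS]linearZ /= schrodingerE !scalerA; congr (_ *: _).
have adj a c : dot (S *m a) c = - dot a (S *m c).
  by rewrite dot_mull hSk mulNmx dotNr.
have betaS : beta (dot v (S *m w)) = beta (dot w (S *m v)).
  by rewrite -[dot v _]opprK -adj betaN // beta_dotC // invrK.
rewrite /skew_char chiDl // !chi_sq // dotDl !adj !betaN //.
rewrite mulmxDr !dotDl !dotDr !adj !betaD // betaS !betaN //.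
move: (beta_neq0 beta_char (dot w (S *m v))) (beta_neq0 beta_char (dot v (S *m v))).
move: (beta_neq0 beta_char (dot w (S *m w))) => h1 h2 h3.
by field; rewrite h1 h2 h3.
Qed.

Lemma fourier_intertwiner :
  #|{: 'cV[B]_m}|%:R != 0 :> C -> intertwiner Sch (omega star m) fourier.
Proof.
move=> q0.
have FF := fourier_inv two_unit beta_char beta_prim beta_star q0.
apply: intertwinerP FF _ => b u w v /=.
rewrite /omega_mx mul_block_col !mul0mx !mul1mx add0r addr0 schrodingerE.
rewrite linearZ /=; apply: wspaceP => c; rewrite linearZ /= ev_fourier.
rewrite [RHS]ev_lfun (bigD1 (c - u)) //= big1 => [|a /negbTE ac].
  rewrite ev_fourier schrodingerE linearZ /= ev_e subrK eqxx mulr1 addr0.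
  rewrite !chiDl // !chiDr // !chiNr // !chi_sq // (beta_dotC _ beta_star u w) //.
  rewrite (beta_dotC _ beta_star u v) //.
  move: (beta_neq0 beta_char (dot u w)) (beta_neq0 beta_char (dot u v)) => h1 h2.
  by field; rewrite h1 h2 oner_neq0.
by rewrite schrodingerE linearZ /= ev_e -subr_eq eq_sym ac !mulr0.
Qed.

(** The factor of a multiple [c *: P] is [c^-1] times that of [P], which undoes
the scalar left open by the choice of the intertwiner. *)
Lemma weilE (I : {set 'cV[B]_m}) g P :
  half_system I -> 2%:R != 0 :> C -> intertwiner Sch g P ->
  weil Sch (g : SLplus star m) = c_factor P *: P.
Proof.
move=> hI n2 PS; rewrite /weil.
have [c c0 ->] := intertwiner_uniq PS (classical_sets.xgetI 0 PS).
rewrite (c_factorZ (opp_eq_vec0 two_unit (m := m)) hI n2 _ c0) scalerA.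
by rewrite mulrAC mulVf ?mul1r.
Qed.

(** Fourier conjugates [T] into the matrix by which [h_T] acts on [N]. *)
Lemma c_factor_inv_star (T : 'M[B]_m) :
  #|{: 'cV[B]_m}|%:R != 0 :> C -> GL_mx T ->
  c_factor (mx_op C (inv_mx (star_mx star T))) = c_factor (mx_op C T).
Proof.
move=> q0 hT.
have /andP[/eqP TT' /eqP T'T] := inv_mxP (star_GL_mx star hT).
have ef : even_op fourier by apply: fourier_even.
have egf := even_opZ #|{: 'cV[B]_m}|%:R^-1 ef.
have FF := fourier_inv two_unit beta_char beta_prim beta_star q0.
apply/esym/(c_factor_conj ef); try exact: mx_op_even.
- by apply: det_on_neq0 FF; apply: even_stab_plus.
- by apply: det_on_neq0 FF; apply: even_stab_minus.
exact: fourier_mx_op.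
Qed.

End Heisenberg.

(** * Determinants of the Fourier operator *)

Section FourierDeterminant.
Variables (B : finUnitRingType) (star : involution B) (C : numClosedFieldType).
Variables (beta : B -> C).
Hypothesis two_unit : 2%:R \is a @GRing.unit B.
Hypothesis beta_char : add_char beta.
Hypothesis beta_prim : primitive beta.
Hypothesis beta_star : forall b, beta (b + star b) = 1.
Local Notation fourier := (fourier star beta).

(** [s] is a square root of [F^2], and [j] the multiplicity of the eigenvalue
[- s] on [U]. *)
Lemma fourier_trace_det m (U : {vspace wspace B C m}) k
    (b : 'I_k -> wspace B C m) c (s : C) :
  dual_frame U b c -> stabilizes U (fourier m) ->
  s != 0 -> s ^+ 2 = #|{: 'cV[B]_m}|%:R ->
  exists j : nat,
    \tr (frame_mx b c (fourier m)) = s * (k%:R - (2 * j)%:R)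
    /\ \det (frame_mx b c (fourier m)) = s ^+ k * (-1) ^+ j.
Proof.
move=> bc FU s0 s2; pose M := s^-1 *: frame_mx b c (fourier m).
have MM : M *m M = 1%:M.
  rewrite -scalemxAl -scalemxAr -(frame_mxM _ bc) // fourier_sq // frame_mxZ.
  by rewrite (frame_mx1 bc) !scalerA -s2 -invfM -expr2 mulVf ?scale1r ?expf_neq0.
have [|j [tM dM]] := involutive_mx_trace_det _ MM; first by rewrite pnatr_eq0.
exists j; have -> : frame_mx b c (fourier m) = s *: M.
  by rewrite scalerA divff ?scale1r.
by rewrite mxtraceZ tM detZ dM.
Qed.

Lemma full_frame m : dual_frame fullv
  (fun i : 'I_#|{: 'cV[B]_m}| => e C (enum_val i))
  (fun j => ev (enum_val j) : {scalar wspace B C m}).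
Proof.
split=> [i|i j|x _]; first exact: memvf.
  by rewrite /= ev_e (inj_eq enum_val_inj) eq_sym.
rewrite {1}[x]e_expansion (eq_bigl (mem {: 'cV[B]_m})) //.
by rewrite big_enum_val.
Qed.

(** In dimension one, the Fourier operator has trace [s ^+ 2 = |B|], all its
diagonal entries being [1], and eigenvalues [s] and [- s]. So [s ^+ 2] is an
integer multiple of [s], and [s] is an integer. *)
Lemma card_square : exists r : nat, #|B| = (r ^ 2)%N.
Proof.
have cardB : #|{: 'cV[B]_1}| = #|B| by rewrite card_mx expn1.
pose s : C := sqrtC #|B|%:R.
have s2 : s ^+ 2 = #|{: 'cV[B]_1}|%:R by rewrite sqrtCK cardB.
have s0 : s != 0.
  by rewrite sqrtC_eq0 pnatr_eq0 -lt0n; apply/card_gt0P; exists 0.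
have FU : stabilizes fullv (fourier 1) by move=> x _; apply: memvf.
have [j [tF _]] := fourier_trace_det (@full_frame 1) FU s0 s2.
have trF : \tr (frame_mx (fun i : 'I_#|{: 'cV[B]_1}| => e C (enum_val i))
    (fun j => ev (enum_val j)) (fourier 1)) = s ^+ 2.
  rewrite s2 /mxtrace; under eq_bigr do rewrite mxE /= ev_fourier chi_diag //.
  by rewrite sumr_const card_ord.
move: tF; rewrite trF expr2 => /(mulfI s0) sE.
rewrite cardB in s2 sE.
pose z : int := #|B|%:Z - (2 * j)%:Z.
have zs : z%:~R = s by rewrite sE rmorphB.
exists `|z|%N; apply/eqP; rewrite -eqz_nat -abszX gez0_abs ?sqr_ge0 //.
by rewrite -(eqr_int C) rmorphXn /= zs s2.
Qed.

Variables (m n : nat) (I : {set 'cV[B]_m}).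
Hypothesis m2n : m = (2 * n)%N.
Hypothesis m_ge2 : (2 <= m)%N.
Hypothesis hI : half_system I.

(** [|B|^n] is the square of an odd number: [|B|] is a square, and it is odd
because [|B|^m = 1 + 2 |I|] with [m] positive. *)
Lemma card_B_pow_mod4 : #|B| ^ n = 1 %[mod 4].
Proof.
have [r Br] := card_square.
have : odd #|{: 'cV[B]_m}|.
  by rewrite (card_half_system (opp_eq_vec0 two_unit (m := m)) hI) oddD mul2n
    odd_double.
rewrite card_mx muln1 m2n oddX Br oddX; case: n m2n m_ge2 => [->|n' _ _] //=.
rewrite -expnM mulnC expnM => r_odd; have : odd (r ^ n'.+1) by rewrite oddX r_odd orbT.
move: (r ^ _)%N => t t_odd; rewrite -(odd_double_half t) t_odd.
move: t./2 => h.
have -> : ((true + h.*2) ^ 2 = (h + h ^ 2) * 4 + 1)%N by lia.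
by rewrite modnMDl.
Qed.

(** With [s = |B|^n], the traces give [|I| = 2 jm] on odd functions and
[s = 1 + |I| - 2 jp] on even functions; as [s ^ 2 = 1 + 2 |I|], the total
[jp + jm] is [s (s - 1) / 2], an even number. *)
Lemma c_factor_fourier : c_factor (fourier m) = (#|B|%:R ^+ n)^-1.
Proof.
have no2 := opp_eq_vec0 two_unit (m := m).
have n2 : 2%:R != 0 :> C by rewrite pnatr_eq0.
have ef : even_op (fourier m) by apply: fourier_even.
pose s : C := #|B|%:R ^+ n.
have s0 : s != 0.
  by rewrite expf_neq0 // pnatr_eq0 -lt0n; apply/card_gt0P; exists 0.
have cardX : #|{: 'cV[B]_m}| = ((#|B| ^ n) ^ 2)%N.
  by rewrite card_mx muln1 m2n mulnC expnM.
have s2 : s ^+ 2 = #|{: 'cV[B]_m}|%:R by rewrite cardX !natrX.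
have pf := plus_frame C no2 hI; have mf := minus_frame no2 hI n2.
have pF := even_stab_plus ef; have mF := even_stab_minus ef.
have [jp [tp dp]] := fourier_trace_det pf pF s0 s2.
have [jm [tm dm]] := fourier_trace_det mf mF s0 s2.
have cN a : chi star beta (- a) a = 1 by rewrite chiNl // chi_diag // invr1.
(* e_v - e_{-v} contributes chi v v - chi (- v) v = 0 to the trace *)
have d_even : #|I| = (2 * jm)%N.
  have : \tr (frame_mx (@minus_vec B C m I) (@minus_coord B C m I)
                (fourier m)) = 0.
    apply: big1 => i _; rewrite minus_mxE !ev_fourier.
    by rewrite chi_diag // cN subrr.
  rewrite tm => /eqP; rewrite mulf_eq0 (negbTE s0) subr_eq0 eqr_nat.
  by move/eqP.
have plus_trace : (#|B| ^ n + 2 * jp = 1 + #|I|)%N.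
  have trp : \tr (frame_mx (@plus_vec B C m I) (@plus_coord B C m I) (fourier m))
      = s ^+ 2.
    rewrite plus_mxE mxtrace_block mxtrace_scalar mulr1n ev_fourier chi_diag //.
    rewrite /mxtrace; under eq_bigr do rewrite mxE !ev_fourier chi_diag // cN.
    rewrite sumr_const card_ord s2 (card_half_system no2 hI) natrD natrM.
    by rewrite -mulr2n mulr_natr.
  move: tp; rewrite trp expr2 => /(mulfI s0) /eqP.
  by rewrite eq_sym subr_eq /s -natrX -natrD eqr_nat eq_sym => /eqP.
have jj_even : odd (jp + jm) = false.
  have := card_B_pow_mod4.
  have : ((#|B| ^ n) ^ 2 = 1 + 2 * #|I|)%N.
    by rewrite -cardX; apply: card_half_system no2 hI.
  move: (#|B| ^ n)%N plus_trace => t plus_trace card_t t1.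
  have [k tk] : exists k, t = (k * 4 + 1)%N.
    by exists (t %/ 4)%N; rewrite {1}(divn_eq t 4) t1.
  have jj : (2 * (jp + jm) + t = t * t)%N by rewrite mulnn card_t; lia.
  have tt : (t * t = 4 * (k * t) + t)%N by rewrite {1}tk; lia.
  have -> : (jp + jm = (k * t).*2)%N by lia.
  exact: odd_double.
rewrite /c_factor (det_onE pf pF) (det_onE mf mF) dp dm exprD expr1.
have -> : (-1) ^+ jp = (-1) ^+ jm :> C.
  move/negbT: jj_even; rewrite oddD negb_add => /eqP jpm.
  by rewrite -signr_odd jpm signr_odd.
have sd0 : s ^+ #|I| * (-1) ^+ jm != 0.
  by rewrite mulf_neq0 // ?signr_eq0 // expf_neq0.
by rewrite -mulrA invfM -mulrA mulVf ?mulr1.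
Qed.

End FourierDeterminant.

(** * The Weil representation on the Bruhat elements *)

Theorem theorem11p1 (R : realType) (B : finUnitRingType) (star : involution B)
    (beta : B -> R[i]) (m n : nat) (I : {set 'cV[B]_m})
    (Sch : heis B m -> 'End(wspace B R[i] m)) :
  2%:R \is a @GRing.unit B ->
  add_char beta ->
  primitive beta ->
  (forall b, beta (b + star b) = 1) ->
  m = (2 * n)%N ->
  (2 <= m)%N ->
  half_system I ->
  schrodinger star beta Sch ->
  let W := @weil B star R[i] m Sch in
  let e := @e B R[i] m in
  [/\ forall (T : 'M[B]_m) (hT : GL_mx T) (a : 'cV[B]_m),
        W (bruhat_h star hT) (e a)
        = mu R[i] I T *: e (inv_mx (star_mx star T) *m a),
      forall (S : 'M[B]_m) (hS : star_mx star S = - S) (a : 'cV[B]_m),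
        W (bruhat_u hS) (e a)
        = beta (- (star_mx star a *m S *m a) 0 0) *: e a
    & forall a : 'cV[B]_m,
        W (omega star m) (e a)
        = (#|B|%:R ^+ n)^-1 *:
          \sum_(b : 'cV[B]_m) beta (2%:R * (star_mx star a *m b) 0 0) *: e b].
Proof.
move=> two_unit beta_char beta_prim beta_star m2n m_ge2 hI hS W e'.
have no2 := opp_eq_vec0 two_unit (m := m).
have n2 : 2%:R != 0 :> R[i] by rewrite pnatr_eq0.
have card_neq0 : #|{: 'cV[B]_m}|%:R != 0 :> R[i].
  by rewrite pnatr_eq0 -lt0n; apply/card_gt0P; exists 0.
have WE := weilE two_unit beta_char beta_prim beta_star hS hI n2.
split=> [T hT a|S hSk a|a].
- rewrite /W (WE _ _ (mx_op_intertwiner beta_char beta_star hS hT)).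
  rewrite (c_factor_inv_star two_unit beta_char beta_prim beta_star) //.
  by rewrite scale_lfunE mx_opE (c_factor_mx_op no2 hI).
- rewrite /W (WE _ _ (mult_op_intertwiner beta_char beta_star hS hSk)).
  rewrite (c_factor_mult_op no2 hI n2) ?scale1r ?mult_opE.
  + by rewrite /skew_char /dot mulmxA.
  + by rewrite /skew_char dot0l oppr0 beta0.
  + by move=> b; apply: beta_neq0.
  exact: skew_charN.
have PF := fourier_intertwiner two_unit beta_char beta_prim beta_star hS card_neq0.
rewrite /W (WE _ _ PF) scale_lfunE fourierE.
by rewrite (c_factor_fourier two_unit beta_char beta_prim beta_star m2n m_ge2 hI).
Qed.
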